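(* For all positive integers $n$ and all $\varepsilon\in(0,1/2)$, $$\mathsf{Q}^{\mathsf{pri}}_{\varepsilon}(\mathsf{EQ}_n)\le\log\left(\frac{\sqrt{n}}{\varepsilon}\right)+3.$$
   Context: All logarithms are base 2. $\mathsf{EQ}_n:\{0,1\}^n\times\{0,1\}^n\to\{0,1\}$ is the Equality function: $\mathsf{EQ}_n(x,y)=1$ iff $x=y$. $\mathsf{Q}^{\mathsf{pri}}_{\varepsilon}(F)$ denotes the minimum cost of a quantum communication protocol computing $F$ with error at most $\varepsilon$ on every input $(x,y)$ (Alice holds $x$, Bob holds $y$), where the players may use private randomness (so messages may be mixed states) but share neither randomness nor entanglement beforehand, and at the end a player performs a measurement and outputs a bit. The cost is the total amount of quantum communication, where sending a $d$-dimensional quantum system costs $\log d$ qubits (not rounded to an integer). In particular, one-way protocols are allowed: Alice sends a density matrix $\rho_x$ on $\mathbb{C}^d$, and Bob measures it with projectors $\{P_y,I-P_y\}$ and outputs 1 on the first outcome and 0 otherwise; this outputs 1 with probability $\mathrm{tr}(P_y\rho_x)$ and has cost $\log d$. *)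

(* Defs.v *)
From mathcomp Require Import all_boot all_order all_algebra.
From mathcomp Require Import all_classical all_reals all_analysis.
From mathcomp Require Import complex mxtens.

Set Implicit Arguments.
Unset Strict Implicit.
Unset Printing Implicit Defensive.

Import Order.TTheory GRing.Theory Num.Theory.
Local Open Scope ring_scope.

Definition log2 (R : realType) (x : R) : R := ln x / ln 2.

Definition adjmx (R : realType) m n (A : 'M[R[i]]_(m, n)) : 'M[R[i]]_(n, m) :=
  map_mx (@Num.conj R[i]) A^T.

(* In R[i], [0 <= z] means that z is real and nonnegative; over the complex
   numbers this makes a positive semidefinite matrix Hermitian. *)
Definition psdmx (R : realType) n (A : 'M[R[i]]_n) : Prop :=
  forall v : 'cV[R[i]]_n, 0 <= (adjmx v *m A *m v) 0 0.

Record density (R : realType) (n : nat) := Density {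
  density_mx :> 'M[R[i]]_n;
  density_psd : psdmx density_mx;
  density_tr : \tr density_mx = 1 }.

(* A two-outcome measurement {E, I - E}, given by its element E for outcome 1;
   it is projective when E is a projector. *)
Record effect (R : realType) (n : nat) := Effect {
  effect_mx :> 'M[R[i]]_n;
  effect_psd : psdmx effect_mx;
  effect_compl_psd : psdmx (1%:M - effect_mx) }.

(* A completely positive trace-preserving map from operators on C^m to
   operators on C^n, presented by Kraus operators. *)
Record channel (R : realType) (m n : nat) := Channel {
  kraus : seq 'M[R[i]]_(n, m);
  kraus_tp : \sum_(K <- kraus) adjmx K *m K = 1%:M }.

(* The action of a channel on one half of a bipartite system C^a (x) C^b. *)
Definition channel_onA (R : realType) (a a' b : nat) (Phi : channel R a a')
    (rho : 'M[R[i]]_(a * b)) : 'M[R[i]]_(a' * b) :=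
  \sum_(K <- kraus Phi)
    (K *t (1%:M : 'M[R[i]]_b)) *m rho *m adjmx (K *t (1%:M : 'M[R[i]]_b)).

Definition channel_onB (R : realType) (a b b' : nat) (Phi : channel R b b')
    (rho : 'M[R[i]]_(a * b)) : 'M[R[i]]_(a * b') :=
  \sum_(K <- kraus Phi)
    ((1%:M : 'M[R[i]]_a) *t K) *m rho *m adjmx ((1%:M : 'M[R[i]]_a) *t K).

(* Interaction when Alice holds a register C^a and Bob a register C^b.
   [AliceSends a' d Phi T]: on input x, Alice applies the local channel Phi x
   from C^a to C^a' (x) C^d, keeps C^a', and sends C^d to Bob; then T follows.
   [BobSends] is symmetric.  The output bit is the outcome of a measurement
   by one player of his or her whole register.  The order of the messages and
   their dimensions depend neither on the inputs nor on the run. *)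
Inductive interaction (R : realType) (X Y : Type) (a b : nat) : Type :=
| AliceOutputs of (X -> effect R a)
| BobOutputs of (Y -> effect R b)
| AliceSends (a' d : nat) of (X -> channel R a (a' * d)) &
    interaction R X Y a' (d * b)
| BobSends (d b' : nat) of (Y -> channel R b (d * b')) &
    interaction R X Y (a * d) b'.

(* The tensor product of mxtens orders the basis lexicographically, so
   re-bracketing a triple tensor product is just a cast along [mulnA]. *)
Fixpoint accept_from (R : realType) (X Y : Type) (a b : nat)
    (T : interaction R X Y a b) (x : X) (y : Y) {struct T} :
    'M[R[i]]_(a * b) -> R :=
  match T with
  | AliceOutputs E =>
      fun rho => complex.Re
        (\tr ((effect_mx (E x) *t (1%:M : 'M[R[i]]_b)) *m rho))
  | BobOutputs E =>
      fun rho => complex.Re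
        (\tr (((1%:M : 'M[R[i]]_a) *t effect_mx (E y)) *m rho))
  | AliceSends a' d Phi T' => fun rho =>
      accept_from T' x y
        (castmx (esym (mulnA a' d b), esym (mulnA a' d b))
                (channel_onA (Phi x) rho))
  | BobSends d b' Phi T' => fun rho =>
      accept_from T' x y
        (castmx (mulnA a d b', mulnA a d b') (channel_onB (Phi y) rho))
  end.

Fixpoint interaction_cost (R : realType) (X Y : Type) (a b : nat)
    (T : interaction R X Y a b) {struct T} : R :=
  match T with
  | AliceOutputs _ | BobOutputs _ => 0
  | AliceSends _ d _ T' => log2 d%:R + interaction_cost T'
  | BobSends d _ _ T' => log2 d%:R + interaction_cost T'
  end.

(* The players start in a product state: each prepares a register of arbitrary
   dimension in a mixed state (private randomness and ancillas) depending only
   on his or her own input; nothing is shared beforehand. *)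
Record protocol (R : realType) (X Y : Type) := Protocol {
  dimA : nat;
  dimB : nat;
  initA : X -> density R dimA;
  initB : Y -> density R dimB;
  body : interaction R X Y dimA dimB }.

Definition cost (R : realType) (X Y : Type) (P : protocol R X Y) : R :=
  interaction_cost (body P).

Definition accept_prob (R : realType) (X Y : Type) (P : protocol R X Y)
    (x : X) (y : Y) : R :=
  accept_from (body P) x y (density_mx (initA P x) *t density_mx (initB P y)).

Definition error_prob (R : realType) (X Y : Type) (P : protocol R X Y)
    (F : X -> Y -> bool) (x : X) (y : Y) : R :=
  if F x y then 1 - accept_prob P x y else accept_prob P x y.

Definition computes (R : realType) (X Y : Type) (P : protocol R X Y)
    (eps : R) (F : X -> Y -> bool) : Prop :=
  forall x y, error_prob P F x y <= eps.

(* Costs are logarithms of positive integers, so the infimum of a nonempty set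
   of costs is attained; over the empty set it is +oo. *)
Definition Qpri (R : realType) (X Y : Type) (eps : R) (F : X -> Y -> bool) :
    \bar R :=
  ereal_inf [set (cost P)%:E | P in
    [set P : protocol R X Y | computes P eps F]]%classic.

Definition EQ (n : nat) (x y : n.-tuple bool) : bool := x == y.

(* Main.v *)
Require Import Defs.
From mathcomp Require Import all_boot all_order all_algebra.
From mathcomp Require Import all_classical all_reals all_analysis.
From mathcomp Require Import complex mxtens ring lra.

(** A one-way protocol on C^d with d = floor (8 sqrt n / eps). To every input
    x attach r = floor (2 sqrt n) sign vectors in {-1, 1}^d; Alice sends the
    uniform mixture of the corresponding pure states, and Bob measures with
    the orthogonal projector P_y onto the span of the vectors attached to y,
    so that equal inputs are always accepted. For x <> y the acceptance
    probability is (r d)^-1 \sum_k <g_k, P_y g_k>, which is typically about r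
    / d, well below eps, because rank P_y <= r. When the g_k are uniformly
    random signs independent of P_y, a Chernoff bound for Rademacher quadratic
    forms shows that it exceeds eps with probability at most exp (- 3 n / 2) <
    4^-n, and a union bound over the pairs (x, y) yields a good family. *)

Set Implicit Arguments.
Unset Strict Implicit.
Unset Printing Implicit Defensive.

Import Order.TTheory GRing.Theory Num.Theory.
Import numFieldNormedType.Exports.
Local Open Scope classical_set_scope.
Local Open Scope ring_scope.

(** * Exponential moment of a single random sign *)

Lemma ge0_derive_le (R : realType) (f df : R -> R) (y : R) :
  (forall x : R, is_derive x (1 : R) f (df x)) ->
  (forall x, 0 <= x -> 0 <= df x) ->
  0 <= y -> f 0 <= f y.
Proof.
move=> fD df0 y0; rewrite -subr_ge0.
have fC : {within `[0, y]%classic, continuous f}.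
  apply: continuous_subspaceT => x.
  by apply/differentiable_continuous/derivable1_diffP; case: (fD x).
have [c + ->] := MVT_segment y0 (fun x _ => fD x) fC.
by rewrite in_itv/= subr0 => /andP[c0 _]; rewrite mulr_ge0// df0.
Qed.

(** This is cosh y <= exp (y^2 / 2). By evenness y >= 0 may be assumed, and there exp (- z^2 / 2)
    cosh z is nonincreasing in z. *)
Lemma expRDexpRN_le (R : realType) (y : R) :
  expR y + expR (- y) <= 2 * expR (y ^+ 2 / 2).
Proof.
wlog y0 : y / 0 <= y => [H|].
  have [/H//|/ltW y0] := leP 0 y.
  by have := H (- y); rewrite opprK sqrrN oppr_ge0 addrC; apply.
(* This is tanh x <= x, the sign of the derivative of exp(-z^2/2) cosh z. *)
have k0 (x : R) : 0 <= x -> (1 - x) * expR x <= (1 + x) * expR (- x).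
  move=> x0; rewrite -subr_ge0.
  have := @ge0_derive_le _
    (fun z : R => (1 + z) * expR (- z) - (1 - z) * expR z)
   (fun z => z * (expR z - expR (- z))) x.
  rewrite /= !oppr0 !expR0 !addr0 subrr; apply => //.
    move=> z; apply: is_derive_eq; rewrite /GRing.scale/=; ring.
  move=> z z0; rewrite mulr_ge0// subr_ge0 ler_expR; lra.
have := @ge0_derive_le _
  (fun z : R => - (expR (- (z ^+ 2 / 2)) * (expR z + expR (- z))))
  (fun z => expR (- (z ^+ 2 / 2)) *
            ((1 + z) * expR (- z) - (1 - z) * expR z)) y.
rewrite expr0n/= mul0r oppr0 !expR0 lerN2 mul1r => /(_ _ _ y0) H.
rewrite -ler_pdivrMr ?expR_gt0// -expRN mulrC.
have -> : 2 = 1 + 1 :> R by [].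
apply: H => [z|z z0]; last by rewrite mulr_ge0 ?expR_ge0// subr_ge0 k0.
by apply: is_derive_eq; rewrite /GRing.scale/=; field.
Qed.

(** * Orthogonal projectors onto spans *)

(** Gram-Schmidt: a vector [v] not fixed by [P] has a residual [u = v - v *m P] orthogonal to the
    range of [P]; adding the rank-one projector onto [u] raises the trace by exactly 1. *)
Lemma exists_orth_projector (R : realFieldType) (d : nat) (s : seq 'rV[R]_d) :
  exists P : 'M[R]_d,
    [/\ P^T = P, P *m P = P, {in s, forall v, v *m P = v} &
        \tr P <= (size s)%:R].
Proof.
elim: s => [|v s [P [PT PP Ps trP]]].
  by exists 0; rewrite trmx0 mul0mx mxtrace0; split.
have [vP|vP] := eqVneq (v *m P) v.
  exists P; split => //; last by rewrite (le_trans trP)// ler_nat.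
  by move=> w; rewrite inE => /predU1P[->|/Ps].
have [u uE] : exists u, u = v - v *m P by exists (v - v *m P).
pose c := (u *m u^T) 0 0.
have uP : u *m P = 0 by rewrite uE mulmxBl -mulmxA PP subrr.
have PuT : P *m u^T = 0 by rewrite -PT -trmx_mul uP trmx0.
(* [c] is a sum of squares, so its vanishing would force [u = 0], that is [v *m P = v]. *)
have c0 : c != 0.
  apply: contraNneq vP => c0; rewrite eq_sym -subr_eq0 -uE; apply/eqP/rowP => j.
  have := c0; rewrite /c mxE => /eqP; rewrite psumr_eq0 => [/allP/(_ j)|i _].
    rewrite mem_index_enum [u^T _ _]mxE mulf_eq0 orbb => /(_ isT)/eqP.
    by rewrite !mxE.
  by rewrite [u^T _ _]mxE -expr2 sqr_ge0.
have uu : u *m u^T = c%:M by rewrite [LHS]mx11_scalar.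
exists (P + c^-1 *: (u^T *m u)); split.
- by rewrite linearD linearZ/= trmx_mul trmxK PT.
- rewrite mulmxDl !mulmxDr PP -!scalemxAl -!scalemxAr -!mulmxA uP mulmx0.
  rewrite [P *m _]mulmxA PuT mul0mx !scaler0 add0r addr0; congr (_ + _).
  rewrite [u *m (_ *m _)]mulmxA uu mul_scalar_mx -scalemxAr !scalerA.
  by rewrite mulrCA mulVf// mulr1.
- move=> w; rewrite inE => /predU1P[->|ws].
    have vu : v *m u^T = c%:M.
      by rewrite -uu {2}uE mulmxBl -mulmxA PuT mulmx0 subr0.
    rewrite mulmxDr -scalemxAr mulmxA vu mul_scalar_mx scalerA mulVf// scale1r.
    by rewrite uE addrC subrK.
  have wu : w *m u^T = 0.
    by rewrite -(Ps _ ws) -mulmxA PuT mulmx0.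
  by rewrite mulmxDr -scalemxAr mulmxA wu mul0mx scaler0 addr0 Ps.
- rewrite mxtraceD mxtraceZ mxtrace_mulC uu mxtrace_scalar mulVf//=.
  by rewrite -natr1 lerD2r.
Qed.

(** * Union bound by counting *)

(* Resampling the value of G at x preserves the uniform distribution, so for a
   fixed pair x <> y the proportion of bad G is at most that of bad a for b. *)
Lemma exists_family_avoiding (X T : finType) (bad : T -> T -> bool) :
  (0 < #|T|)%N ->
  (forall b, #|[pred a | bad a b]| * #|X| ^ 2 < #|T|)%N ->
  exists G : X -> T, forall x y, x != y -> ~~ bad (G x) (G y).
Proof.
move=> T0 Hbad.
pose U := {ffun X -> T}.
have U0 : (0 < #|{: U}|)%N by rewrite card_ffun expn_gt0 T0.
(* [sw x] exchanges [G x] with a fresh sample. It is an involution, so reindexing by it makes the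
   value at [x] independent of [G y]. *)
pose sw x (p : U * T) : U * T :=
  ([ffun z => if z == x then p.2 else p.1 z], p.1 x).
have swK x : cancel (sw x) (sw x).
  move=> [G a]; rewrite /sw /=; congr (_, _); last by rewrite ffunE eqxx.
  by apply/ffunP => z; rewrite !ffunE; case: eqP => // ->.
have one x y : x != y ->
    (\sum_(G : U) bad (G x) (G y) * #|X| ^ 2 <= #|{: U}|.-1)%N.
  move=> xy; rewrite -ltnS prednK// -(ltn_pmul2r T0) big_distrl/=.
  have -> : (\sum_(G : U) (bad (G x) (G y) * #|X| ^ 2) * #|T| =
             \sum_(p : U * T) bad (p.1 x) (p.1 y) * #|X| ^ 2)%N.
    rewrite -(pair_bigA _
      (fun (G : U) (_ : T) => bad (G x) (G y) * #|X| ^ 2)%N)/=.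
    by apply: eq_bigr => G _; rewrite sum_nat_const mulnC.
  rewrite (reindex_inj (can_inj (swK x)))/=.
  under eq_bigr do rewrite !ffunE eqxx [y == x]eq_sym (negbTE xy).
  rewrite -(pair_bigA _ (fun (G : U) (a : T) => bad a (G y) * #|X| ^ 2)%N)/=.
  apply: leq_ltn_trans (_ : #|{: U}| * #|T|.-1 < _)%N; last first.
    by rewrite ltn_pmul2l// prednK.
  rewrite -sum_nat_const; apply: leq_sum => G _.
  rewrite -big_distrl/= -ltnS prednK//.
  suff -> : (\sum_(a : T) bad a (G y) = #|[pred a | bad a (G y)]|)%N by [].
  rewrite -sum1_card [RHS]big_mkcond; apply: eq_bigr => a _.
  by rewrite inE; case: (bad a _).
have [[G HG]|H] := pselect
  (exists G : U, forall x y, x != y -> ~~ bad (G x) (G y)).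
  by exists G.
have : (0 < #|X|)%N.
  rewrite lt0n; apply/eqP => X0; apply: H.
  have /card_gt0P[t _] := T0.
  by exists [ffun=> t] => x; have := max_card (pred1 x); rewrite X0 card1.
move=> X0.
(* Double counting: by [one] the sum falls short of [#|X| ^ 2 * #|{: U}|], yet if every [G] had a
   bad pair, each would contribute at least [#|X| ^ 2]. *)
have: (\sum_(x : X) \sum_(y : X | x != y)
       \sum_(G : U) bad (G x) (G y) * #|X| ^ 2 < #|X| ^ 2 * #|{: U}|)%N.
  apply: leq_ltn_trans (_ : \sum_(x : X) \sum_(y : X) #|{: U}|.-1 < _)%N.
    apply: leq_sum => x _; rewrite big_mkcond; apply: leq_sum => y _.
    by case: ifP => // /one.
  by rewrite !sum_nat_const mulnA mulnn ltn_pmul2l ?expn_gt0 ?X0// prednK.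
have : (#|X| ^ 2 * #|{: U}| <= \sum_(G : U)
    \sum_(x : X) \sum_(y : X | x != y) bad (G x) (G y) * #|X| ^ 2)%N.
  rewrite mulnC -sum_nat_const; apply: leq_sum => G _.
  have [x [y [xy b]]] : exists x y, x != y /\ bad (G x) (G y).
    apply: contrapT => nH; apply: H; exists G => x y xy; apply/negP => b.
    by apply: nH; exists x, y.
  by rewrite (bigD1 x)//= (bigD1 y)//= b mul1n -addnA leq_addr.
rewrite exchange_big/=; under eq_bigr do rewrite exchange_big/=.
by move=> /leq_ltn_trans/[apply]; rewrite ltnn.
Qed.

(** * Quadratic forms and their exponential moments over sign vectors *)

Definition qform (R : pzRingType) m (B : 'M[R]_m) (x : 'rV[R]_m) : R :=
  (x *m B *m x^T) 0 0.

Definition signv (R : pzRingType) m (g : 'rV[bool]_m) : 'rV[R]_m :=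
  map_mx (fun b : bool => (-1) ^+ b) g.

Lemma qformZ (R : comPzRingType) m (a : R) (B : 'M[R]_m) x :
  qform (a *: B) x = a * qform B x.
Proof. by rewrite /qform -scalemxAr -scalemxAl mxE. Qed.

Lemma qform_block (R : comPzRingType) m (a : R) (u w : 'rV[R]_m) (B : 'M[R]_m)
    (s : R) :
  qform (block_mx a%:M u u^T B : 'M[R]_(1 + m)) (row_mx s%:M w) =
  s ^+ 2 * a + 2 * s * (u *m w^T) 0 0 + qform B w.
Proof.
rewrite /qform mul_row_block tr_row_mx mul_row_col !mulmxDl tr_scalar_mx.
rewrite -!scalar_mxM !mul_scalar_mx mul_mx_scalar -scalemxAl.
have -> : w *m u^T = (u *m w^T)^T by rewrite trmx_mul trmxK.
rewrite !mxE eqxx mulr1n; ring.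
Qed.

Lemma qform_row0 (R : pzRingType) m (C : 'M[R]_(1 + m)) (w : 'rV[R]_m) :
  qform C (row_mx 0 w) = qform (drsubmx C) w.
Proof.
rewrite -{1}[C]submxK /qform mul_row_block tr_row_mx.
by rewrite mul_row_col trmx0 !(mul0mx, mulmx0) !add0r.
Qed.

Lemma qform_row1 (R : pzRingType) m (C : 'M[R]_(1 + m)) :
  qform C (row_mx 1%:M 0) = C 0 0.
Proof.
rewrite -{1}[C]submxK /qform mul_row_block tr_row_mx.
rewrite mul_row_col trmx0 !(mul0mx, mulmx0) !addr0 trmx1 mulmx1 mul1mx !mxE.
by congr (C _ _); apply: val_inj.
Qed.

Lemma mxtrace_drsub (R : pzRingType) m (C : 'M[R]_(1 + m)) :
  \tr C = C 0 0 + \tr (drsubmx C).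
Proof.
rewrite -{1}[C]submxK mxtrace_block; congr (_ + _).
rewrite [ulsubmx _]mx11_scalar mxtrace_scalar !mxE.
by congr (C _ _); apply: val_inj.
Qed.

(* Averaging over the first sign s replaces B = (a, u; u^T, B') by
   B'' = B' + 2 u^T u at the cost of a factor exp a, since
   cosh y <= exp (y^2 / 2).  The hypothesis relating B to C survives: it is used
   at the vectors (0, x) and (2 <u, x + t>, t), where a >= 0. *)
Lemma sum_expR_qform_signv (R : realType) m (B C : 'M[R]_m) :
  B^T = B -> (forall x, 0 <= qform B x) ->
  (forall x t, qform B (x + t) <= qform C x + (t *m t^T) 0 0 / 2) ->
  \sum_(g : 'rV[bool]_m) expR (qform B (signv R g)) <= 2 ^+ m * expR (\tr C).
Proof.
elim: m B C => [|m IHm] B C BT B0 BC.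
  rewrite [C]thinmx0 mxtrace0 expR0 mulr1 expr0.
  rewrite (eq_bigr (fun=> 1)) => [|g _].
    by rewrite sumr_const card_mx muln0.
  by rewrite [B]thinmx0 /qform mulmx0 mul0mx mxE expR0.
have [a [u [B' [BE B'T]]]] : exists (a : R) (u : 'rV_m) (B' : 'M[R]_m),
    B = block_mx a%:M u u^T B' :> 'M[R]_(1 + m) /\ B'^T = B'.
  exists (B 0 0), (ursubmx (B : 'M[R]_(1 + m))), (drsubmx (B : 'M[R]_(1 + m))).
  rewrite trmx_drsub BT; split => //.
  rewrite -[LHS](submxK (B : 'M[R]_(1 + m))); congr block_mx.
    by rewrite [LHS]mx11_scalar !mxE; congr (B _ _)%:M; apply: val_inj.
  by rewrite -{1}BT trmx_ursub.
have {}BC (x t : 'rV[R]_(1 + m)) : qform (B : 'M[R]_(1 + m)) (x + t) <=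
    qform (C : 'M[R]_(1 + m)) x + (t *m t^T) 0 0 / 2 by exact: BC.
have a0 : 0 <= a.
  have := B0 (row_mx 1%:M 0 : 'rV_(1 + m)).
  rewrite BE qform_block trmx0 mulmx0 /qform !mul0mx !mxE; lra.
have aC : a <= C 0 0.
  have := BC (row_mx 1%:M 0 : 'rV_(1 + m)) 0.
  rewrite addr0 BE qform_block qform_row1 !trmx0 !mulmx0.
  rewrite /qform !mul0mx !mxE; lra.
have [B'' B''d] : exists B'', B'' = B' + 2 *: (u^T *m u) by eexists.
have B''E w : qform B'' w = qform B' w + 2 * ((u *m w^T) 0 0) ^+ 2.
  rewrite B''d /qform mulmxDr mulmxDl [LHS]mxE; congr (_ + _).
  rewrite -scalemxAr -scalemxAl mxE; congr (_ * _).
  rewrite -!mulmxA mulmxA.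
  have -> : w *m u^T = (u *m w^T)^T by rewrite trmx_mul trmxK.
  by rewrite mxE big_ord1 mxE expr2.
have := IHm B'' (drsubmx (C : 'M[R]_(1 + m))).
have -> : B''^T = B'' by rewrite B''d linearD linearZ/= trmx_mul trmxK B'T.
move=> /(_ erefl) IH.
have {}IH : \sum_g expR (qform B'' (signv R g)) <=
            2 ^+ m * expR (\tr (drsubmx (C : 'M[R]_(1 + m)))).
  apply: IH => [w|x t].
    rewrite B''E addr_ge0//; last by rewrite mulr_ge0// sqr_ge0.
    have := B0 (row_mx 0%:M w : 'rV_(1 + m)).
    rewrite BE qform_block; lra.
  rewrite B''E.
  set z := (u *m _) 0 0.
  (* A first coordinate s adds 2 s z through the cross terms, beyond [s ^+ 2 * a >= 0], net of s^2 /
     2 from the norm. The maximum 2 z^2 of this gain, at s = 2 z, is the extra term of [B'']. *)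
  have := BC (row_mx 0%:M x : 'rV_(1 + m)) (row_mx (2 * z)%:M t).
  rewrite (_ : 0%:M = 0) ?raddf0// add_row_mx add0r qform_row0 BE qform_block.
  rewrite -/z tr_row_mx mul_row_col tr_scalar_mx -scalar_mxM.
  rewrite [X in _ + X / 2]mxE [(_%:M) 0 0]mxE eqxx mulr1n.
  have := mulr_ge0 a0 (sqr_ge0 z); lra.
pose cons_mx b (w : 'rV[bool]_m) : 'rV_(1 + m) := row_mx (const_mx b) w.
have consE b w : signv R (cons_mx b w) = row_mx ((-1) ^+ b)%:M (signv R w).
  rewrite /signv map_row_mx map_const_mx; congr row_mx.
  by apply/matrixP => i j; rewrite !ord1 !mxE eqxx.
rewrite (reindex (fun p : bool * 'rV_m => cons_mx p.1 p.2)); last first.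
  exists (fun g : 'rV_(1 + m) => (g 0 (lshift m 0), rsubmx g)) =>
    [[b w]|g] _ /=.
    rewrite row_mxKr; congr (_, _).
    by rewrite row_mxEl mxE.
  rewrite /cons_mx -[RHS]hsubmxK; congr row_mx.
  by apply/matrixP => i j; rewrite !ord1 !mxE.
rewrite -(pair_bigA _ (fun b w => expR (qform B (signv R (cons_mx b w)))))/=.
rewrite big_bool/= -big_split/=.
apply: (@le_trans _ _ (\sum_(w : 'rV[bool]_m)
    2 * (expR a * expR (qform B'' (signv R w))))).
  apply: ler_sum => w _.
  rewrite !consE BE !qform_block expr0 expr1 expr1n sqrrN expr1n !mul1r B''E.
  set z := (u *m _) 0 0; set q := qform _ _.
  (* The first sign s enters only through exp (2 s z); averaging it costs at most exp (2 z^2), again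
     the extra term of [B'']. *)
  have H := expRDexpRN_le (2 * z).
  rewrite -(ler_pM2l (expR_gt0 (a + q))) mulrDr mulrCA -!expRD in H.
  have -> : a + 2 * -1 * z + q = a + q + - (2 * z) by ring.
  have -> : a + 2 * 1 * z + q = a + q + 2 * z by ring.
  rewrite -expRD addrC (le_trans H)// ler_pM2l// ler_expR le_eqVlt.
  by apply/predU1P; left; field.
rewrite -mulr_sumr -mulr_sumr exprS -mulrA ler_pM2l//.
rewrite mxtrace_drsub expRD mulrCA.
by rewrite ler_pM ?expR_ge0 ?sumr_ge0 ?ler_expR// => w _; rewrite expR_ge0.
Qed.

(** * Forms of projectors and the tail bound *)

Lemma qform1_ge0 (R : realDomainType) m (x : 'rV[R]_m) : 0 <= (x *m x^T) 0 0.
Proof. by rewrite mxE sumr_ge0// => j _; rewrite !mxE -expr2 sqr_ge0. Qed.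

Lemma qform_projE (R : comPzRingType) m (P : 'M[R]_m) x :
  P^T = P -> P *m P = P -> qform P x = (x *m P *m (x *m P)^T) 0 0.
Proof.
by move=> PT PP; rewrite /qform trmx_mul PT mulmxA -[x *m P *m P]mulmxA PP.
Qed.

Lemma qform_proj_le (R : realDomainType) m (P : 'M[R]_m) x :
  P^T = P -> P *m P = P -> 0 <= qform P x <= (x *m x^T) 0 0.
Proof.
move=> PT PP; rewrite qform_projE// qform1_ge0/= -qform_projE// -subr_ge0.
have : 0 <= qform (1%:M - P) x.
  rewrite qform_projE ?qform1_ge0 ?linearB/= ?trmx1 ?PT//.
  by rewrite mulmx1 mulmxBl mul1mx PP subrr subr0.
by rewrite /qform mulmxBr mulmx1 mulmxBl !mxE.
Qed.

Lemma qformD (R : comPzRingType) m (P : 'M[R]_m) x t : P^T = P ->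
  qform P (x + t) = qform P x + 2 * (x *m P *m t^T) 0 0 + qform P t.
Proof.
move=> PT; rewrite /qform linearD/= !mulmxDl !mulmxDr.
have -> : t *m P *m x^T = (x *m P *m t^T)^T.
  by rewrite !trmx_mul trmxK PT mulmxA.
move: (x *m P *m x^T) (x *m P *m t^T) (t *m P *m t^T) => A B C.
by rewrite !mxE; ring.
Qed.

Lemma qformZr (R : comPzRingType) m (P : 'M[R]_m) a x :
  qform P (a *: x) = a ^+ 2 * qform P x.
Proof.
by rewrite /qform linearZ/= -!scalemxAl -scalemxAr scalerA mxE expr2.
Qed.

(* The constants are l = 3/10 and l / (1 - 2 l) = 3/4; with q the form of P,
   3/4 q(x) + |t|^2/2 - 3/10 q(x + t) >= q(3 x - 2 t)/20 >= 0. *)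
Lemma sum_expR_qform_proj (R : realType) m (P : 'M[R]_m) :
  P^T = P -> P *m P = P ->
  \sum_(g : 'rV[bool]_m) expR (3 / 10 * qform P (signv R g)) <=
  2 ^+ m * expR (3 / 4 * \tr P).
Proof.
move=> PT PP; rewrite -mxtraceZ.
under eq_bigr do rewrite -qformZ.
apply: sum_expR_qform_signv => [|x|x t].
- by rewrite linearZ/= PT.
- by rewrite qformZ mulr_ge0//; have /andP[] := qform_proj_le x PT PP.
have /andP[_ Pt] := qform_proj_le t PT PP.
have /andP[+ _] := qform_proj_le (3 *: x + (- 2) *: t) PT PP.
rewrite !qformZ !qformD// !qformZr linearZ/= -!scalemxAl -scalemxAr scalerA.
by move: (x *m P *m t^T) => M; rewrite [(_ *: M) _ _]mxE; lra.
Qed.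

(** Markov's inequality for the exponential of 3/10 times the sum. The [r] sign vectors are
    independent, so the moment is an [r]-th power, with each factor at most
    [2 ^+ d * expR (3 / 4 * r%:R)]. *)
Lemma card_sum_qform_gt (R : realType) (d r : nat) (P : 'M[R]_d) (tau : R) :
  P^T = P -> P *m P = P -> \tr P <= r%:R ->
  #|[pred A : {ffun 'I_r -> 'rV[bool]_d} |
      tau < \sum_k qform P (signv R (A k))]|%:R <=
  #|{: {ffun 'I_r -> 'rV[bool]_d}}|%:R *
    expR (3 / 4 * r%:R ^+ 2 - 3 / 10 * tau).
Proof.
move=> PT PP trP.
rewrite expRD expRN mulrA ler_pdivlMr ?expR_gt0//.
apply: (@le_trans _ _ (\sum_(A : {ffun 'I_r -> 'rV[bool]_d})
    expR (\sum_k 3 / 10 * qform P (signv R (A k))))).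
  rewrite -sum1_card natr_sum mulr_suml big_mkcond; apply: ler_sum => A _.
  rewrite inE; case: ifP => [/ltW tauA|_]; last exact: expR_ge0.
  by rewrite mul1r ler_expR -mulr_sumr ler_pM2l.
under eq_bigr do rewrite expR_sum.
rewrite -(bigA_distr_bigA (fun _ g => expR (3 / 10 * qform P (signv R g)))).
rewrite prodr_const card_ord card_ffun card_ord card_mx card_bool mul1n !natrX.
have -> : 3 / 4 * r%:R ^+ 2 = 3 / 4 * r%:R * r%:R :> R by ring.
rewrite expRM_natr -exprMn.
rewrite lerXn2r ?nnegrE ?sumr_ge0 ?mulr_ge0 ?exprn_ge0 ?expR_ge0//.
apply: le_trans (sum_expR_qform_proj PT PP) _.
by rewrite ler_pM2l ?exprn_gt0// ler_expR ler_pM2l.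
Qed.

(** * From real vectors and projectors to a quantum protocol *)

Lemma adjmx_real (R : realType) m n (A : 'M[R]_(m, n)) :
  adjmx (map_mx (real_complex R) A) = map_mx (real_complex R) A^T.
Proof. by apply/matrixP => i j; rewrite !mxE; apply: conjc_real. Qed.

Lemma adjmxM (R : realType) m n p (A : 'M[R[i]]_(m, n)) (B : 'M[R[i]]_(n, p)) :
  adjmx (A *m B) = adjmx B *m adjmx A.
Proof. by rewrite /adjmx trmx_mul map_mxM. Qed.

Lemma psdmx_adjmxM (R : realType) m n (A : 'M[R[i]]_(m, n)) :
  psdmx (adjmx A *m A).
Proof.
move=> v; rewrite mulmxA -adjmxM -mulmxA mxE sumr_ge0// => i _.
by rewrite !mxE mulrC mul_conjC_ge0.
Qed.

Lemma psdmx_proj (R : realType) n (P : 'M[R]_n) :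
  P^T = P -> P *m P = P -> psdmx (map_mx (real_complex R) P).
Proof.
move=> PT PP; rewrite -{1}PP map_mxM -{1}PT -adjmx_real; exact: psdmx_adjmxM.
Qed.

Lemma psdmx_castmx (R : realType) m n (e : m = n) (A : 'M[R[i]]_m) :
  psdmx A -> psdmx (castmx (e, e) A).
Proof. by case: n / e. Qed.

(** The cast is needed because Bob finally holds a register of dimension [d * 1], only
    propositionally equal to [d]. *)
Lemma projector_effect (R : realType) m n (e : m = n) (P : 'M[R]_m) :
  P^T = P -> P *m P = P ->
  exists E : effect R n,
    effect_mx E = castmx (e, e) (map_mx (real_complex R) P).
Proof.
move=> PT PP; have psd := psdmx_castmx e (psdmx_proj PT PP).
suff psdC : psdmx (1%:M - castmx (e, e) (map_mx (real_complex R) P)).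
  by exists (Effect psd psdC).
suff -> : 1%:M - castmx (e, e) (map_mx (real_complex R) P) =
          castmx (e, e) (map_mx (real_complex R) (1%:M - P)).
  apply/psdmx_castmx/psdmx_proj; first by rewrite linearB/= trmx1 PT.
  by rewrite mulmxBr mulmx1 mulmxBl mul1mx PP subrr subr0.
by case: n / e {psd}; rewrite !castmx_id raddfB/= map_mx1.
Qed.

Lemma psdmx1 (R : realType) n : psdmx (1%:M : 'M[R[i]]_n).
Proof.
have := @psdmx_adjmxM R n n 1%:M.
by rewrite mulmx1 /adjmx trmx1 map_mx1.
Qed.

Definition density1 (R : realType) : density R 1 :=
  Density (@psdmx1 R 1) (mxtrace1 _ 1).

Lemma mxtrace_castmx_rank1 (R : realType) d m n l (I : finType)
    (eA : d = n) (eS : m = n) (eK : d = m) (el el' : 1%N = l)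
    (A : 'M[R[i]]_d) (v : I -> 'cV[R[i]]_d) :
  \tr (castmx (eA, eA) A *m castmx (eS, eS) (\sum_k
    castmx (eK, el) (v k) *m castmx (el', el') 1%:M *m
      adjmx (castmx (eK, el) (v k)))) =
  \sum_k (adjmx (v k) *m A *m v k) 0 0.
Proof.
case: n / eA eS => eS; case: m / eK eS => eS; case: l / el el' => el'.
rewrite (eq_irrelevance eS erefl) (eq_irrelevance el' erefl) !castmx_id.
rewrite mulmx_sumr raddf_sum/=.
apply: eq_bigr => k _; rewrite !castmx_id mulmx1 mulmxA mxtrace_mulC mulmxA.
by rewrite /mxtrace big_ord1.
Qed.

(** Both players start with trivial registers. The columns [psi x k] serve as Kraus operators out of
    C^1: their squared norms are the mixture weights, and trace preservation says that these sum to
    1. *)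
Lemma one_way_protocol (R : realType) (X Y : Type) (d r : nat)
    (psi : X -> 'I_r -> 'rV[R]_d) (P : Y -> 'M[R]_d) :
  (forall x, \sum_k (psi x k *m (psi x k)^T) 0 0 = 1) ->
  (forall y, (P y)^T = P y) -> (forall y, P y *m P y = P y) ->
  exists p : protocol R X Y,
    cost p = log2 d%:R /\
    forall x y, accept_prob p x y = \sum_k qform (P y) (psi x k).
Proof.
move=> psi1 PT PP.
pose v x k : 'cV[R[i]]_d := map_mx (real_complex R) (psi x k)^T.
pose K x k : 'M[R[i]]_(1 * d, 1) := castmx (esym (mul1n d), erefl) (v x k).
have Ktp x : \sum_(A <- [seq K x k | k <- index_enum 'I_r]) adjmx A *m A = 1%:M.
  rewrite big_map/=.
  transitivity (\sum_k adjmx (v x k) *m v x k).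
    by apply: eq_bigr => k _; rewrite /K; case: _ / (esym (mul1n d)).
  under eq_bigr do rewrite /v adjmx_real trmxK -map_mxM.
  rewrite -(raddf_sum (map_mx (real_complex R))) [LHS]mx11_scalar mxE.
  by rewrite summxE psi1 rmorph1.
have /choice[E EP] : forall y, exists E : effect R (d * 1), effect_mx E =
    castmx (esym (muln1 d), esym (muln1 d)) (map_mx (real_complex R) (P y)).
  by move=> y; apply: projector_effect.
pose T := @AliceSends R X Y 1 1 1 d (fun x => Channel (Ktp x))
            (@BobOutputs R X Y 1 (d * 1) E).
exists (@Protocol R X Y 1 1 (fun=> density1 R) (fun=> density1 R) T).
split => [|x y]; first by rewrite /cost/= addr0.
rewrite /accept_prob/= /channel_onA/= big_map/= EP.
rewrite !tens_scalar_mx !scale1r castmx_comp.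
under eq_bigr do rewrite tens_mx_scalar scale1r /K castmx_comp.
rewrite mxtrace_castmx_rank1.
rewrite raddf_sum; apply: eq_bigr => k _.
by rewrite /v adjmx_real trmxK -!map_mxM mxE.
Qed.

(** * Existence of the code and choice of parameters *)

Lemma signv_norm (R : realDomainType) m (g : 'rV[bool]_m) :
  (signv R g *m (signv R g)^T) 0 0 = m%:R.
Proof.
rewrite mxE (eq_bigr (fun=> 1)) => [|j _].
  by rewrite sumr_const card_ord.
by rewrite !mxE -expr2 sqrr_sign.
Qed.

Lemma lt4_expR (R : realType) : 4 < expR (3 / 2 : R).
Proof.
(* exp (1/8) >= 9/8 suffices, since (9/8)^12 is about 4.11. *)
have -> : 3 / 2 = 12%:R * (1 / 8) :> R by field.
rewrite expRM_natl; apply: (@lt_le_trans _ _ ((9 / 8) ^+ 12)); first by lra.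
by rewrite lerXn2r ?nnegrE ?expR_ge0//; have := expR_ge1Dx (1 / 8 : R); lra.
Qed.

Lemma expR_exp4_lt1 (R : realType) (n : nat) (t : R) :
  (0 < n)%N -> t <= - (3 / 2) * n%:R -> expR t * 4 ^+ n < 1.
Proof.
move=> n0 tn; apply: (@le_lt_trans _ _ ((expR (- (3 / 2)) * 4) ^+ n)).
  by rewrite exprMn -expRM_natr ler_pM2r ?exprn_gt0// ler_expR.
rewrite exprn_ilt1 ?mulr_ge0 ?expR_ge0 ?lt0n_neq0//.
by rewrite expRN mulrC ltr_pdivrMr ?expR_gt0// mul1r lt4_expR.
Qed.

(** There are at most 4^n pairs of inputs. With the family of y fixed, its projector is fixed too,
    and the tail bound applies to the random family of x. *)
Lemma exists_code (R : realType) (X : finType) (n d r : nat) (eps : R) :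
  (0 < n)%N -> (#|X| <= 2 ^ n)%N ->
  3 / 4 * r%:R ^+ 2 - 3 / 10 * (eps * (r%:R * d%:R)) <= - (3 / 2) * n%:R ->
  exists (v : X -> 'I_r -> 'rV[R]_d) (P : X -> 'M[R]_d),
    [/\ forall x k, (v x k *m (v x k)^T) 0 0 = d%:R,
        forall x, (P x)^T = P x, forall x, P x *m P x = P x,
        forall x k, v x k *m P x = v x k &
        forall x y, x != y ->
          \sum_k qform (P y) (v x k) <= eps * (r%:R * d%:R)].
Proof.
move=> n0 Xn Hexp; pose T := {ffun 'I_r -> 'rV[bool]_d}.
have /choice[P HP] : forall A : T, exists P : 'M[R]_d,
    [/\ P^T = P, P *m P = P, forall k, signv R (A k) *m P = signv R (A k) &
        \tr P <= r%:R].
  move=> A; have [P [PT PP PA trP]] :=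
    exists_orth_projector [seq signv R (A k) | k <- enum 'I_r].
  exists P; split => // [k|].
    by rewrite PA//; apply/mapP; exists k; rewrite ?mem_enum.
  by rewrite size_map size_enum_ord in trP.
have T0 : (0 < #|{: T}|)%N by apply/card_gt0P; exists [ffun=> const_mx true].
pose bad (a b : T) := eps * (r%:R * d%:R) < \sum_k qform (P b) (signv R (a k)).
have [b|G HG] := @exists_family_avoiding X T bad T0.
  have [PT PP _ trP] := HP b.
  have Hc := card_sum_qform_gt (eps * (r%:R * d%:R)) PT PP trP.
  rewrite -(ltr_nat R) natrM.
  apply: (@le_lt_trans _ _ (#|{: T}|%:R * (expR
    (3 / 4 * r%:R ^+ 2 - 3 / 10 * (eps * (r%:R * d%:R))) * 4 ^+ n))).
    rewrite mulrA ler_pM// natrX (_ : 4 = 2 ^+ 2); last by ring.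
    by rewrite exprAC lerXn2r ?nnegrE ?exprn_ge0// -natrX ler_nat.
  by rewrite gtr_pMr ?ltr0n// expR_exp4_lt1.
exists (fun x k => signv R (G x k)), (fun x => P (G x)); split.
- by move=> x k; exact: signv_norm.
- by move=> x; have [] := HP (G x).
- by move=> x; have [] := HP (G x).
- by move=> x k; have [] := HP (G x).
- by move=> x y /HG; rewrite /bad -leNgt.
Qed.

Lemma EQ_protocol (R : realType) (n d r : nat) (eps : R) :
  (0 < n)%N -> (0 < d)%N -> (0 < r)%N -> 0 <= eps ->
  3 / 4 * r%:R ^+ 2 - 3 / 10 * (eps * (r%:R * d%:R)) <= - (3 / 2) * n%:R ->
  exists p : protocol R (n.-tuple bool) (n.-tuple bool),
    cost p = log2 d%:R /\ computes p eps (@EQ n).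
Proof.
move=> n0 d0 r0 eps0 Hexp.
have Xn : (#|{: n.-tuple bool}| <= 2 ^ n)%N by rewrite card_tuple card_bool.
have [v [P [v1 PT PP vP Pv]]] := exists_code n0 Xn Hexp.
have rd0 : 0 < r%:R * d%:R :> R by rewrite mulr_gt0 ?ltr0n.
(* Each of the [r] sign vectors has squared norm [d]; scaling by [c] makes the total weight 1. *)
pose c : R := (Num.sqrt (r%:R * d%:R))^-1.
have c2 : c ^+ 2 = (r%:R * d%:R)^-1 by rewrite exprVn sqr_sqrtr// ltW.
have [|p [pc pa]] :=
    @one_way_protocol R _ _ d r (fun x k => c *: v x k) P _ PT PP.
  move=> x; rewrite (eq_bigr (fun=> c ^+ 2 * d%:R)) => [|k _].
    by rewrite sumr_const card_ord c2 -[LHS]mulr_natl mulrCA mulVf ?gt_eqF.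
  by rewrite linearZ/= -scalemxAl -scalemxAr scalerA mxE v1 expr2.
exists p; split => // x y; rewrite /error_prob /EQ pa.
under eq_bigr do rewrite qformZr.
rewrite -mulr_sumr c2; case: eqVneq => [<-|xy].
  under eq_bigr do rewrite /qform vP v1.
  by rewrite sumr_const card_ord -[d%:R *+ r]mulr_natl mulVf ?gt_eqF// subrr.
by rewrite mulrC ler_pdivrMr// Pv.
Qed.

Theorem theorem1p11 (R : realType) (n : nat) (eps : R) :
  (0 < n)%N -> 0 < eps -> eps < 1 / 2 ->
  (Qpri eps (@EQ n) <= (log2 (Num.sqrt n%:R / eps) + 3)%:E)%E.
Proof.
move=> n0 eps0 eps2.
pose s : R := Num.sqrt n%:R.
have s2 : s ^+ 2 = n%:R by rewrite sqr_sqrtr.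
have s1 : 1 <= s by rewrite -[1]sqrtr1 ler_sqrt// ler1n.
have se0 : 0 < s / eps by rewrite divr_gt0//; lra.
(* The factor 8 = 2^3 is the additive 3 in the cost. *)
pose d := Num.truncn (8 * (s / eps)); pose r := Num.truncn (2 * s).
have /andP[dle ltd] : d%:R <= 8 * (s / eps) < d.+1%:R.
  by rewrite truncn_itv// mulr_ge0// ltW.
have /andP[rle ltr] : r%:R <= 2 * s < r.+1%:R.
  by rewrite truncn_itv// mulr_ge0//; lra.
rewrite -[r.+1%:R]natr1 in ltr; rewrite -[d.+1%:R]natr1 in ltd.
(* Truncation loses less than [eps], and [eps < 1 / 2 <= s / 2]. *)
have ed : 15 / 2 * s <= eps * d%:R.
  have : 8 * s < eps * (d%:R + 1).
    by rewrite [eps * _]mulrC -ltr_pdivrMr// -mulrA.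
  lra.
have d0 : (0 < d)%N.
  by rewrite -(ltr_nat R) -(pmulr_rgt0 _ eps0); lra.
have r0 : (0 < r)%N by rewrite -(ltr_nat R); lra.
(* r lies in [s, 2 s], where 3/4 (r^2 - 3 r s + 2 s^2) <= 0. *)
have Hexp : 3 / 4 * r%:R ^+ 2 - 3 / 10 * (eps * (r%:R * d%:R)) <=
            - (3 / 2) * n%:R :> R.
  have H1 : 0 <= (r%:R - s) * (2 * s - r%:R) by rewrite mulr_ge0//; lra.
  have H2 : r%:R * (15 / 2 * s) <= r%:R * (eps * d%:R) by rewrite ler_wpM2l.
  by rewrite -s2; nra.
have [p [pc pE]] := EQ_protocol n0 d0 r0 (ltW eps0) Hexp.
apply: (@le_trans _ _ (cost p)%:E); first by apply: ereal_inf_lbound; exists p.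
rewrite lee_fin pc /log2 -/s -lerBlDr.
have ln2 : 0 < ln 2 :> R by rewrite ln_gt0// ltr1n.
rewrite -[3](mulfK (lt0r_neq0 ln2)) -mulrBl ler_pM2r ?invr_gt0// lerBlDr.
have -> : 3 * ln 2 = ln 8 :> R.
  by rewrite mulr_natl -lnXn//; congr ln; ring.
by rewrite addrC -lnM ?posrE// ler_ln ?posrE ?ltr0n// mulr_gt0.
Qed.
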